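(* Let $v:\mathbb{R}^2\to\mathbb{R}^2$ be a unit vector field (i.e. $\|v(x,y)\|_2=1$ for all $(x,y)\in\mathbb{R}^2$) that is Lipschitz with constant $K>0$, and let $0<T<\frac1K$. Then for each $t$ with $|t|\le T$ the map $S_t:\mathbb{R}^2\to\mathbb{R}^2$, $S_t(x,y)=(x,y)+t\,v(x,y)$, is one to one and onto. Furthermore, denoting by $\mu$ Lebesgue measure on $\mathbb{R}^2$, for all measurable sets $A\subset\mathbb{R}^2$ and all $|s|\le T$, $$\frac{1}{2\pi(1+|s|K)^2}\,\mu(S_s(A))\le\mu(A)\le 2\pi\Big(\frac{1}{1-|s|K}\Big)^2\mu(S_s(A)).$$
   Context: Lipschitz with constant $K$ means $\|v(X)-v(Y)\|\le K\|X-Y\|$ for all $X,Y\in\mathbb{R}^2$, with the Euclidean norm. *)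

(* Defs.v *)
From HB Require Import structures.
From mathcomp Require Import all_boot all_order all_algebra.
From mathcomp Require Import all_classical all_reals all_analysis.

Set Implicit Arguments.
Unset Strict Implicit.
Unset Printing Implicit Defensive.

Import Order.TTheory GRing.Theory Num.Theory.
Import numFieldNormedType.Exports.

Local Open Scope classical_set_scope.
Local Open Scope ring_scope.

(* The library norm of [R * R] is the max norm, and its Lipschitz notation
   [k.-lipschitz_on] refers to that norm; hence the two definitions below. *)
Definition euclidean_norm {R : realType} (p : R * R) : R :=
  Num.sqrt (p.1 ^+ 2 + p.2 ^+ 2).

Definition euclidean_lipschitz {R : realType} (K : R) (v : R * R -> R * R) :=
  forall p q : R * R,
    euclidean_norm (v p - v q) <= K * euclidean_norm (p - q).

Definition unit_vector_field {R : realType} (v : R * R -> R * R) :=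
  forall p : R * R, euclidean_norm (v p) = 1.

Definition translate_along {R : realType} (v : R * R -> R * R) (t : R) (p : R * R) :
  R * R := p + t *: v p.

(* [lebesgue_measure] lives on the Borel sets of [R], so the product measure
   lives on the Borel sets of [R * R]. Lebesgue measurable sets and Lebesgue
   measure on [R * R] are obtained from it by Caratheodory's construction, as
   the library does for [completed_lebesgue_measure] in dimension one. *)
Definition lebesgue_measurable2 {R : realType} (A : set (R * R)) : Prop :=
  ((@lebesgue_measure R \x @lebesgue_measure R)%E^*)%mu.-cara.-measurable A.

Definition lebesgue_measure2 {R : realType} (A : set (R * R)) : \bar R :=
  @completed_measure_extension _ _ _
    (@lebesgue_measure R \x @lebesgue_measure R)%E A.

(* Main.v *)
(** The map [translate_along v s] is bi-Lipschitz for the Euclidean norm, with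
    constants [1 + |s| K] and [1 / (1 - |s| K)]; it is onto
    because [q |-> p - s v(q)] is a contraction. An [L]-Lipschitz map sends a
    square of side [w] into a square of side [sqrt 2 L w]; a rectangle is covered
    by squares of at most twice its area, and the measure is computed by covers
    by rectangles, so outer measure grows by at most [4 L^2 <= 2 pi L^2]. As for
    measurability, a measurable set of finite measure is a Borel set minus a
    null set, and the map preserves both kinds of sets. *)
Require Import Defs.
From HB Require Import structures.
From mathcomp Require Import all_boot all_order all_algebra.
From mathcomp Require Import all_classical all_reals all_analysis.
From mathcomp Require Import ring lra.
Import Order.TTheory GRing.Theory Num.Theory.
Import numFieldNormedType.Exports.
Local Open Scope classical_set_scope.
Local Open Scope ring_scope.

(** * The semiring of rectangles with measurable sides *)

Section rectangles.
Context {d1 d2 : measure_display}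
  (T1 : semiRingOfSetsType d1) (T2 : semiRingOfSetsType d2).

(* A copy of [T1 * T2], since the product itself already carries the product
   sigma-algebra. *)
Definition rectangle_type : Type := (T1 * T2)%type.

Definition rectangle : set (set rectangle_type) :=
  [set A `*` B | A in measurable & B in measurable].

Lemma rectangle0 : rectangle set0.
Proof. by exists set0 => //; exists set0 => //; rewrite setX0. Qed.

Lemma rectangleI : setI_closed rectangle.
Proof.
move=> _ _ [A mA [B mB <-]] [C mC [D mD <-]].
exists (A `&` C); first exact: measurableI.
by exists (B `&` D); [exact: measurableI|rewrite setXI].
Qed.

(** [(A * B) \ (C * D)] is the disjoint union of [(A \ C) * B] and [(A & C) * (B \ D)], and each
    one-dimensional difference splits into finitely many disjoint measurable pieces. *)
Lemma semi_rectangleD : semi_setD_closed rectangle.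
Proof.
move=> _ _ [A mA [B mB <-]] [C mC [D mD <-]].
have [DA [fDA mDA ACE tDA]] := semi_measurableD _ _ mA mC.
have [DB [fDB mDB BDE tDB]] := semi_measurableD _ _ mB mD.
exists ([set X `*` B | X in DA] `|` [set (A `&` C) `*` Y | Y in DB]); split.
- by rewrite finite_setU; split; exact: finite_image.
- move=> _ [[X DAX <-]|[Y DBY <-]].
    by exists X; [exact: mDA|exists B].
  by exists (A `&` C); [exact: measurableI|exists Y => //; exact: mDB].
- rewrite bigcup_setU !bigcup_image -setX_bigcupl -setX_bigcupr -ACE -BDE.
  apply/seteqP; split => [[x y] [[/= Ax By] CDxy]|[x y]].
    have [Cx|nCx] := pselect (C x); last by left.
    by right; split => //; split => // Dy; exact: CDxy.
  by move=> [[[/= Ax nCx] By]|[[/= Ax Cx] [By nDy]]]; split => // -[].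
- move=> _ _ [[X DX <-]|[Y DY <-]] [[X' DX' <-]|[Y' DY' <-]].
  + by move=> [[x y] [[/= ? ?] [? ?]]]; rewrite (tDA X X') //; exists x.
  + move=> [[x y] [[/= Xx ?] [[? Cx] ?]]].
    by have [] : (A `\` C) x by rewrite ACE; exists X.
  + move=> [[x y] [[[/= ? Cx] ?] [Xx ?]]].
    by have [] : (A `\` C) x by rewrite ACE; exists X'.
  + by move=> [[x y] [[/= ? ?] [? ?]]]; rewrite (tDB Y Y') //; exists y.
Qed.

(** An opaque tag: it keeps the structure on rectangles from being unified with those of the
    factors. *)
Definition rectangle_display : measure_display -> measure_display -> measure_display.
Proof. exact. Qed.

HB.instance Definition _ := Pointed.on rectangle_type.
HB.instance Definition _ := @isSemiRingOfSets.Build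
  (rectangle_display d1 d2) rectangle_type rectangle
  rectangle0 rectangleI semi_rectangleD.

End rectangles.

(** * Half-open boxes and the product measure on them *)

Section box_outer_measure.
Variable R : realType.

Local Notation box := (rectangle_type (ocitv_type R) (ocitv_type R)).
Local Notation lambda := (@lebesgue_measure R).
Local Notation mu := (lambda \x lambda)%E.
Local Notation plane := (measurableTypeR R * measurableTypeR R)%type.

(** The product sigma-algebra is generated by the preimages of half-open intervals under the two
    projections. Such a strip is the countable union of the boxes whose other side is []-k, k]]. *)
Lemma measurable_planeE :
  (measurable : set (set plane)) = <<s (measurable : set (set box)) >>.
Proof.
have cover : setT = \bigcup_k `](- k%:R)%R, k%:R]%classic :> set R.
  by rewrite bigcup_itvT.
apply/seteqP; split.
  apply: smallest_sub; first exact: smallest_sigma_algebra.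
  rewrite subUset; split.
    rewrite -(g_sigma_preimageE _ (@fst (measurableTypeR R) (measurableTypeR R))).
    apply: smallest_sub; first exact: smallest_sigma_algebra.
    move=> _ [I mI <-]; rewrite setTI.
    have -> : fst @^-1` I = \bigcup_k (I `*` `](- k%:R)%R, k%:R]%classic) :> set plane.
      by rewrite -setX_bigcupr -cover setXT.
    apply: sigma_algebra_bigcup => k; apply: sub_sigma_algebra.
    exists I => //; exists `](- k%:R)%R, k%:R]%classic => //; exact: is_ocitv.
  rewrite -(g_sigma_preimageE _ (@snd (measurableTypeR R) (measurableTypeR R))).
  apply: smallest_sub; first exact: smallest_sigma_algebra.
  move=> _ [I mI <-]; rewrite setTI.
  have -> : snd @^-1` I = \bigcup_k (`](- k%:R)%R, k%:R]%classic `*` I) :> set plane.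
    by rewrite -setX_bigcupl -cover setTX.
  apply: sigma_algebra_bigcup => k; apply: sub_sigma_algebra.
  exists `](- k%:R)%R, k%:R]%classic; first exact: is_ocitv.
  by exists I.
apply: smallest_sub; first exact: sigma_algebra_measurable.
move=> _ [A mA [B mB <-]].
by apply: measurableX; exact: sub_sigma_algebra.
Qed.

(** The product measure retyped on the semiring of boxes, so that its outer measure [mu_ext] uses
    covers by boxes only. *)
Definition box_measure : set box -> \bar R := mu.

Lemma box_measurable (A : set box) :
  measurable A -> (measurable : set (set plane)) A.
Proof. by move=> mA; rewrite measurable_planeE; exact: sub_sigma_algebra. Qed.

Let box_measure0 : box_measure set0 = 0%E.
Proof. exact: (measure0 mu). Qed.

Let box_measure_ge0 A : (0 <= box_measure A)%E.
Proof. exact: (measure_ge0 mu). Qed.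

Let box_measure_semi_sigma_additive : semi_sigma_additive box_measure.
Proof.
move=> F mF tF mUF; apply: (@measure_semi_sigma_additive _ _ _ mu F) => //.
- by move=> i; exact: box_measurable.
- exact: box_measurable.
Qed.

HB.instance Definition _ := isMeasure.Build _ _ _ box_measure
  box_measure0 box_measure_ge0 box_measure_semi_sigma_additive.

Lemma box_measure_itv (a b c d : R) : a <= b -> c <= d ->
  box_measure (`]a, b]%classic `*` `]c, d]%classic) = ((b - a) * (d - c))%:E.
Proof.
have itvE (x y : R) : x <= y -> lambda `]x, y]%classic = (y - x)%:E.
  move=> xy; rewrite lebesgue_measure_itv/= lte_fin -EFinB.
  by move: xy; rewrite le_eqVlt => /predU1P[->|->//]; rewrite ltxx subrr.
move=> ab cd; rewrite EFinM -(itvE _ _ ab) -(itvE _ _ cd).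
by apply: product_measure1E; exact: measurable_itv.
Qed.

(** Serves twice: for uniqueness of the extension from boxes, and to cut a measurable set into
    pieces of finite measure. *)
Lemma box_measure_sigma_finite : sigma_finite setT box_measure.
Proof.
exists (fun k => `](- k%:R)%R, k%:R]%classic `*` `](- k%:R)%R, k%:R]%classic).
  apply/esym/seteqP; split => // -[x y] _.
  have : setT x by [].
  have : setT y by [].
  rewrite -(bigcup_itvT false false) => -[i _ /=] + [j _ /=].
  rewrite !in_itv/= => /andP[iy yi] /andP[jx xj].
  have im : (i%:R <= (maxn i j)%:R :> R)%R by rewrite ler_nat leq_maxl.
  have jm : (j%:R <= (maxn i j)%:R :> R)%R by rewrite ler_nat leq_maxr.
  by exists (maxn i j) => //=; split; rewrite /= in_itv/=; apply/andP; split; lra.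
move=> k; split.
  exists `](- k%:R)%R, k%:R]%classic; first exact: is_ocitv.
  by exists `](- k%:R)%R, k%:R]%classic => //; exact: is_ocitv.
by rewrite box_measure_itv ?ltry// lerNl// ge0_cp.
Qed.

End box_outer_measure.

(** * Lebesgue outer measure of the plane through covers by boxes *)

Section lebesgue_measure2_theory.
Variable R : realType.

Local Notation box := (rectangle_type (ocitv_type R) (ocitv_type R)).
Local Notation lambda := (@lebesgue_measure R).
Local Notation mu := (lambda \x lambda)%E.
Local Notation plane := (measurableTypeR R * measurableTypeR R)%type.
Local Notation box_sigma := (g_sigma_algebraType (measurable : set (set box))).

(** The product measure again, now typed on the sigma-algebra generated by the boxes, where
    uniqueness of extension applies. *)
Definition plane_measure : set box_sigma -> \bar R := mu.

Let plane_measure0 : plane_measure set0 = 0%E.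
Proof. exact: (measure0 mu). Qed.

Let plane_measure_ge0 A : (0 <= plane_measure A)%E.
Proof. exact: (measure_ge0 mu). Qed.

Let plane_measure_semi_sigma_additive : semi_sigma_additive plane_measure.
Proof.
move=> F mF tF mUF; apply: (@measure_semi_sigma_additive _ _ _ mu F) => //.
- by move=> i; rewrite measurable_planeE; exact: mF.
- by rewrite measurable_planeE.
Qed.

HB.instance Definition _ := isMeasure.Build _ _ _ plane_measure
  plane_measure0 plane_measure_ge0 plane_measure_semi_sigma_additive.

Lemma mu_ext_box (A : set plane) : measurable A ->
  mu_ext (@box_measure R) A = mu A.
Proof.
rewrite measurable_planeE => mA.
exact: (@measure_extension_unique _ _ _ _ (@box_measure_sigma_finite R)
  plane_measure (fun _ _ => erefl) A mA).
Qed.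

(** A cover by boxes is a cover by Borel sets, which gives one inequality. For the other, the box
    outer measure is countably subadditive and agrees with [mu] on Borel sets. *)
Lemma lebesgue_measure2E (A : set (R * R)) :
  lebesgue_measure2 A = mu_ext (@box_measure R) A.
Proof.
apply/eqP; rewrite eq_le; apply/andP; split.
  apply: le_ereal_inf_tmp => _ [F [mF AF] <-].
  apply: ereal_inf_lbound; exists F => //; split => // i.
  exact: box_measurable.
apply: le_ereal_inf_tmp => _ [F [mF AF] <-].
apply: (le_trans (le_outer_measure (mu_ext (@box_measure R)) _ _ AF)).
apply: (le_trans (outer_measure_sigma_subadditive (mu_ext (@box_measure R)) F)).
apply: lee_nneseries => [i _ _|i _]; first exact: outer_measure_ge0.
by rewrite -[leRHS](mu_ext_box _ (mF i)).
Qed.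

Lemma lebesgue_measure2_set0 : lebesgue_measure2 (set0 : set (R * R)) = 0%E.
Proof. exact: (outer_measure0 (mu_ext mu)). Qed.

Lemma lebesgue_measure2_ge0 (A : set (R * R)) : (0 <= lebesgue_measure2 A)%E.
Proof. exact: (outer_measure_ge0 (mu_ext mu)). Qed.

Lemma le_lebesgue_measure2 (A B : set (R * R)) : A `<=` B ->
  (lebesgue_measure2 A <= lebesgue_measure2 B)%E.
Proof. exact: (le_outer_measure (mu_ext mu)). Qed.

Lemma lebesgue_measure2_bigcup (F : (set (R * R))^nat) :
  (lebesgue_measure2 (\bigcup_n F n) <= \sum_(n <oo) lebesgue_measure2 (F n))%E.
Proof. exact: (outer_measure_sigma_subadditive (mu_ext mu)). Qed.

Lemma lebesgue_measure2_bigsetU (F : (set (R * R))^nat) n :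
  (lebesgue_measure2 (\big[setU/set0]_(i < n) F i)
     <= \sum_(i < n) lebesgue_measure2 (F i))%E.
Proof. exact: (outer_measure_subadditive (mu_ext mu)). Qed.

Lemma lebesgue_measure2_itv (a b c d : R) : a <= b -> c <= d ->
  lebesgue_measure2 (`[a, b]%classic `*` `[c, d]%classic)
    = ((b - a) * (d - c))%:E.
Proof.
have itvE (x y : R) : x <= y -> lambda `[x, y]%classic = (y - x)%:E.
  move=> xy; rewrite lebesgue_measure_itv/= lte_fin -EFinB.
  by move: xy; rewrite le_eqVlt => /predU1P[->|->//]; rewrite ltxx subrr.
move=> ab cd; rewrite EFinM -(itvE _ _ ab) -(itvE _ _ cd).
have mI (x y : R) : measurable (`[x, y]%classic : set (measurableTypeR R)).
  exact: measurable_itv.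
transitivity (mu (`[a, b]%classic `*` `[c, d]%classic)).
  by apply: measurable_mu_extE; exact: measurableX.
exact: product_measure1E.
Qed.

End lebesgue_measure2_theory.

(** * Outer measure of Lipschitz images *)

Section lipschitz_image.
Variable R : realType.
Implicit Types (f : R * R -> R * R) (p q : R * R) (L : R).

Lemma euclidean_norm_ge_fst p : `|p.1| <= euclidean_norm p.
Proof. by rewrite -sqrtr_sqr ler_wsqrtr// lerDl sqr_ge0. Qed.

Lemma euclidean_norm_ge_snd p : `|p.2| <= euclidean_norm p.
Proof. by rewrite -sqrtr_sqr ler_wsqrtr// lerDr sqr_ge0. Qed.

Lemma euclidean_norm_le (r : R) p : `|p.1| <= r -> `|p.2| <= r ->
  euclidean_norm p <= Num.sqrt 2 * r.
Proof.
move=> p1r p2r; have r0 : 0 <= r by exact: le_trans p1r.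
rewrite -[X in _ * X](ger0_norm r0) -sqrtr_sqr -sqrtrM// ler_wsqrtr//.
rewrite -(real_normK (num_real p.1)) -(real_normK (num_real p.2)).
rewrite mulr_natl mulr2n lerD// lerXn2r// nnegrE//.
Qed.

(** Points of the square are within [sqrt 2 * r] of its centre, so the image lies in the square
    about [f p] of half-side [h = L * sqrt 2 * r], whose area is [(2 * h) ^+ 2]. *)
Lemma lipschitz_image_square f L p (r : R) : 0 <= L -> 0 <= r ->
  euclidean_lipschitz L f ->
  (lebesgue_measure2
     (f @` (`[p.1 - r, p.1 + r] `*` `[p.2 - r, p.2 + r])%R)
   <= (8 * L ^+ 2 * r ^+ 2)%:E)%E.
Proof.
move=> L0 r0 lipf; set h := L * (Num.sqrt 2 * r).
have h0 : 0 <= h by rewrite !mulr_ge0// sqrtr_ge0.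
have -> : 8 * L ^+ 2 * r ^+ 2
    = ((f p).1 + h - ((f p).1 - h)) * ((f p).2 + h - ((f p).2 - h)).
  have : Num.sqrt 2 ^+ 2 = 2 :> R by rewrite sqr_sqrtr.
  by rewrite /h; set s := Num.sqrt 2 => s2; ring: s2.
rewrite -lebesgue_measure2_itv; [|lra|lra].
apply: le_lebesgue_measure2 => _ [q [/= + +] <-].
rewrite !in_itv/= -!ler_distl => q1 q2.
have lipq : euclidean_norm (f q - f p) <= h.
  by rewrite (le_trans (lipf q p))// ler_wpM2l// euclidean_norm_le.
split => /=.
  exact: le_trans (euclidean_norm_ge_fst (f q - f p)) lipq.
exact: le_trans (euclidean_norm_ge_snd (f q - f p)) lipq.
Qed.

(* The rectangle is covered by at most [2 * l / w] squares of side [w]. *)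
Lemma lipschitz_image_strip f L (a b w l : R) : 0 <= L -> 0 < w -> w <= l ->
  euclidean_lipschitz L f ->
  (lebesgue_measure2 (f @` (`]a, a + w] `*` `]b, b + l])%R)
   <= (4 * L ^+ 2 * (w * l))%:E)%E.
Proof.
move=> L0 w0 wl lipf; have l0 : 0 < l by exact: lt_le_trans wl.
(* One square more than the integer part, to cover the remainder; [w <= l] pays for it:
   [m * w <= l + w <= 2 * l]. *)
pose m := (Num.truncn (l / w)).+1.
have mw : m%:R * w <= 2 * l.
  rewrite /m -natr1 mulrDl mul1r.
  suff : (Num.truncn (l / w))%:R * w <= l by lra.
  by rewrite -ler_pdivlMr// -truncn_ge_nat// divr_ge0// ltW.
pose c (i : nat) : R * R := (a + w / 2, b + i%:R * w + w / 2).
pose Q (i : nat) := `[(c i).1 - w / 2, (c i).1 + w / 2]%classic `*`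
                    `[(c i).2 - w / 2, (c i).2 + w / 2]%classic.
have cover : f @` (`]a, a + w]%classic `*` `]b, b + l]%classic)
    `<=` \big[setU/set0]_(i < m) (f @` Q i).
  move=> _ [[x y] [/= + +] <-]; rewrite !in_itv/= => /andP[ax xa] /andP[bY yb].
  have yw0 : 0 <= (y - b) / w by rewrite divr_ge0// ?ltW// subr_gt0.
  have /andP[iy yi] := truncn_itv yw0.
  set i := Num.truncn _ in iy yi.
  have im : (i < m)%N.
    by rewrite ltnS le_truncn// ler_pM2r ?invr_gt0//; lra.
  rewrite -(bigcup_mkord m (fun i => f @` Q i)); exists i => //; exists (x, y) => //.
  move: iy yi; rewrite ler_pdivlMr// ltr_pdivrMr// -natr1 mulrDl mul1r => iy yi.
  by split; rewrite /= ?in_itv/=; apply/andP; split; rewrite /c/=; lra.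
apply: (le_trans (le_lebesgue_measure2 _ _ _ cover)).
apply: (le_trans (lebesgue_measure2_bigsetU _ (fun i => f @` Q i) m)).
have Qi (i : 'I_m) : true -> (lebesgue_measure2 (f @` Q i)
    <= (8 * L ^+ 2 * (w / 2) ^+ 2)%:E)%E.
  by move=> _; apply: lipschitz_image_square => //; rewrite divr_ge0// ltW.
apply: (le_trans (lee_sum _ Qi)).
rewrite sumEFin lee_fin sumr_const card_ord -[_ *+ m]mulr_natl.
(* The [m] squares contribute [2 * L ^+ 2 * w ^+ 2] each; one factor [w] stays with [m] so that [mw]
   applies. *)
have -> : m%:R * (8 * L ^+ 2 * (w / 2) ^+ 2) = 2 * L ^+ 2 * w * (m%:R * w) by field.
have -> : 4 * L ^+ 2 * (w * l) = 2 * L ^+ 2 * w * (2 * l) by ring.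
by rewrite ler_wpM2l// !mulr_ge0// ?sqr_ge0// ltW.
Qed.

Lemma lipschitz_image_box f L (a b c d : R) : 0 <= L -> a < b -> c < d ->
  euclidean_lipschitz L f ->
  (lebesgue_measure2 (f @` (`]a, b]%classic `*` `]c, d]%classic))
   <= (4 * L ^+ 2 * ((b - a) * (d - c)))%:E)%E.
Proof.
move=> L0 ab cd lipf.
(* Exchanging the coordinates preserves the Euclidean norm, so the first side may be taken as the
   shorter one. *)
wlog ba_le : f a b c d ab cd lipf / b - a <= d - c => [hwlog|].
  have [|dc_lt] := leP (b - a) (d - c); first exact: hwlog.
  have -> : f @` (`]a, b]%classic `*` `]c, d]%classic)
      = (f \o (fun p => (p.2, p.1))) @` (`]c, d]%classic `*` `]a, b]%classic).
    apply/seteqP; split => [_ [[x y] [/= ? ?] <-]|_ [[y x] [/= ? ?] <-]].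
      by exists (y, x).
    by exists (x, y).
  rewrite [X in _ * X]mulrC; apply: hwlog => //; last exact: ltW.
  move=> p q; apply: (le_trans (lipf _ _)).
  by rewrite /euclidean_norm/= addrC.
have := @lipschitz_image_strip f L a c (b - a) (d - c) L0 _ ba_le lipf.
by rewrite subr_gt0 !subrKC => /(_ ab).
Qed.

Lemma lipschitz_image_le f L (A : set (R * R)) : 0 < L ->
  euclidean_lipschitz L f ->
  (lebesgue_measure2 (f @` A) <= (4 * L ^+ 2)%:E * lebesgue_measure2 A)%E.
Proof.
move=> L0 lipf; have c0 : 0 < 4 * L ^+ 2 by rewrite mulr_gt0// exprn_gt0.
(* With the constant moved to the left, the right side is a bare infimum over box covers, and each
   cover can be treated separately. *)
rewrite -lee_pdivrMl// [leRHS]lebesgue_measure2E.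
apply: le_ereal_inf_tmp => _ [F [mF AF] <-].
rewrite lee_pdivrMl// -nneseriesZl//.
have cover : f @` A `<=` \bigcup_n (f @` F n).
  by rewrite -image_bigcup; exact: image_subset.
apply: (le_trans (le_lebesgue_measure2 _ _ _ cover)).
apply: (le_trans (lebesgue_measure2_bigcup _ (fun n => f @` F n))).
apply: lee_nneseries => [i _ _|i _]; first exact: lebesgue_measure2_ge0.
(* A side of a box may be the empty interval; this bound settles those cases. *)
have fset0 : (lebesgue_measure2 (f @` set0)
    <= (4 * L ^+ 2)%:E * box_measure R set0)%E.
  by rewrite image_set0 lebesgue_measure2_set0 (measure0 (box_measure R)) mule0.
have [I /ocitvP[->|[[a b] /= ab ->]] [J /ocitvP[->|[[c d] /= cd ->]] <-]] := mF i.
- by rewrite setX0.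
- by rewrite set0X.
- by rewrite setX0.
- rewrite (box_measure_itv _ _ _ _ _ (ltW ab) (ltW cd)) -EFinM.
  exact: lipschitz_image_box (ltW L0) ab cd lipf.
Qed.

End lipschitz_image.

(** * The Euclidean norm and Banach's fixed point theorem *)

Section euclidean_contraction.
Variable R : realType.
Implicit Types (f : R * R -> R * R) (p q : R * R) (k : R).

Lemma euclidean_norm_ge0 p : 0 <= euclidean_norm p.
Proof. exact: sqrtr_ge0. Qed.

Lemma euclidean_norm_eq0 p : euclidean_norm p = 0 -> p = 0.
Proof.
move=> p0; have := euclidean_norm_ge_fst _ p; have := euclidean_norm_ge_snd _ p.
rewrite p0 !normr_le0; case: p {p0} => x y /= /eqP -> /eqP ->.
by [].
Qed.

Lemma euclidean_normZ k p : euclidean_norm (k *: p) = `|k| * euclidean_norm p.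
Proof.
rewrite /euclidean_norm -sqrtr_sqr -sqrtrM ?sqr_ge0//; congr Num.sqrt.
by case: p => x y /=; rewrite /GRing.scale/=; ring.
Qed.

Lemma ler_euclidean_normD p q :
  euclidean_norm (p + q) <= euclidean_norm p + euclidean_norm q.
Proof.
have pq0 := addr_ge0 (euclidean_norm_ge0 p) (euclidean_norm_ge0 q).
rewrite -[leRHS](ger0_norm pq0) -sqrtr_sqr ler_wsqrtr//.
have cauchy_schwarz :
    p.1 * q.1 + p.2 * q.2 <= euclidean_norm p * euclidean_norm q.
  apply: (le_trans (ler_norm _)).
  rewrite -sqrtr_sqr -sqrtrM ?addr_ge0 ?sqr_ge0// ler_wsqrtr// -subr_ge0.
  (* Lagrange's identity: the defect in Cauchy-Schwarz is the square of the determinant. *)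
  set D := _ - _.
  have -> : D = (p.1 * q.2 - p.2 * q.1) ^+ 2 by rewrite /D; ring.
  exact: sqr_ge0.
have sqE (z : R * R) : euclidean_norm z ^+ 2 = z.1 ^+ 2 + z.2 ^+ 2.
  by rewrite sqr_sqrtr// addr_ge0// sqr_ge0.
by rewrite [leRHS]sqrrD !sqE /=; lra.
Qed.

Lemma euclidean_normN p : euclidean_norm (- p) = euclidean_norm p.
Proof. by rewrite -scaleN1r euclidean_normZ normrN1 mul1r. Qed.

Lemma euclidean_lipschitz_iter k f n : 0 <= k -> euclidean_lipschitz k f ->
  euclidean_lipschitz (k ^+ n) (iter n f).
Proof.
move=> k0 lipf; elim: n => [|n ih] p q; first by rewrite expr0 mul1r.
by rewrite exprS -mulrA (le_trans (lipf _ _))// ler_wpM2l// ih.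
Qed.

(** [u] is its initial value plus a telescoping series, which converges absolutely by comparison
    with a geometric series. *)
Lemma cvgn_geometric_steps (u : R ^nat) (C k : R) : 0 <= k -> k < 1 ->
  (forall n, `|u n.+1 - u n| <= C * k ^+ n) -> cvgn u.
Proof.
move=> k0 k1 uk; have -> : u = (fun n => u 0%N + series (telescope u) n).
  by apply/funext => n; exact: eq_sum_telescope.
apply: is_cvgD; first exact: is_cvg_cst.
apply: normed_cvg.
apply: (@series_le_cvg _ _ (geometric C k)) => [n|n|n|].
- exact: normr_ge0.
- exact: le_trans (uk n).
- exact: uk.
- by apply: is_cvg_geometric_series; rewrite ger0_norm.
Qed.

(** Iteration from the origin has geometrically decreasing steps, so each coordinate converges in
    [R]; the limit point is then shown to be moved by at most any [e > 0]. *)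
Lemma euclidean_contraction_fixpoint k f : 0 <= k -> k < 1 ->
  euclidean_lipschitz k f -> exists p, f p = p.
Proof.
move=> k0 k1 lipf; pose z n := iter n f 0.
have step n : euclidean_norm (z n.+1 - z n) <= euclidean_norm (f 0 - 0) * k ^+ n.
  rewrite mulrC /z iterSr; exact: euclidean_lipschitz_iter.
have cvg1 : cvgn (fun n => (z n).1).
  apply: (cvgn_geometric_steps _ _ _ k0 k1) => n.
  exact: le_trans (euclidean_norm_ge_fst _ (z n.+1 - z n)) (step n).
have cvg2 : cvgn (fun n => (z n).2).
  apply: (cvgn_geometric_steps _ _ _ k0 k1) => n.
  exact: le_trans (euclidean_norm_ge_snd _ (z n.+1 - z n)) (step n).
set x := limn (fun n => (z n).1); set y := limn (fun n => (z n).2).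
exists (x, y); apply/subr0_eq/euclidean_norm_eq0/eqP.
rewrite eq_le euclidean_norm_ge0 andbT; apply/ler_addgt0Pr => e e0.
(* Two coordinates within [e / 4] give a distance of at most [e / 2], and two such distances are
   added at the end. *)
have e4 : 0 < e / 4 by rewrite divr_gt0.
have /cvgrPdist_lt/(_ _ e4) [N1 _ near1] := cvg1.
have /cvgrPdist_lt/(_ _ e4) [N2 _ near2] := cvg2.
rewrite add0r; pose n := maxn N1 N2.
have N1n : (N1 <= n)%N by exact: leq_maxl.
have N2n : (N2 <= n)%N by exact: leq_maxr.
have dist m : `|x - (z m).1| < e / 4 -> `|y - (z m).2| < e / 4 ->
    euclidean_norm ((x, y) - z m) <= e / 2.
  move=> xm ym.
  have -> : (x, y) - z m = (x - (z m).1, 0) + (0, y - (z m).2).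
    by congr pair; rewrite /= ?addr0 ?add0r.
  apply: (le_trans (ler_euclidean_normD _ _)).
  rewrite /euclidean_norm/= expr0n/= addr0 add0r !sqrtr_sqr; lra.
have near_n : euclidean_norm ((x, y) - z n) <= e / 2.
  by apply: dist; [exact: near1|exact: near2].
have near_n1 : euclidean_norm ((x, y) - z n.+1) <= e / 2.
  by apply: dist; [apply: near1|apply: near2]; exact: leqW.
(* The detour goes through [z n.+1], which is [f (z n)]. *)
have -> : f (x, y) - (x, y) = (f (x, y) - f (z n)) + - ((x, y) - z n.+1).
  by rewrite opprB addrA subrK.
apply: (le_trans (ler_euclidean_normD _ _)); rewrite euclidean_normN.
have fn : euclidean_norm (f (x, y) - f (z n)) <= e / 2.
  apply: (le_trans (lipf _ _)); apply: le_trans near_n.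
  by rewrite ler_piMl ?euclidean_norm_ge0// ltW.
lra.
Qed.

End euclidean_contraction.

(** * Bijectivity and bi-Lipschitz bounds for [translate_along] *)

Section translate_along_bijection.
Variables (R : realType) (v : R * R -> R * R) (K t : R).
Hypotheses (v_lip : euclidean_lipschitz K v) (tK : `|t| * K < 1) (K0 : 0 <= K).

Lemma translate_along_lipschitz :
  euclidean_lipschitz (1 + `|t| * K) (translate_along v t).
Proof.
move=> p q; rewrite /translate_along opprD addrACA -scalerBr mulrDl mul1r.
apply: (le_trans (ler_euclidean_normD _ _ _)); rewrite lerD2l.
by rewrite euclidean_normZ -mulrA ler_wpM2l.
Qed.

(** Reverse triangle inequality: the displacement terms differ by at most [|t| * K] times the
    distance of the points. It yields both injectivity and the Lipschitz constant of the inverse. *)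
Lemma translate_along_expanding p q :
  (1 - `|t| * K) * euclidean_norm (p - q)
    <= euclidean_norm (translate_along v t p - translate_along v t q).
Proof.
rewrite mulrBl mul1r lerBlDr.
have -> : p - q = (translate_along v t p - translate_along v t q)
    + - (t *: (v p - v q)).
  by rewrite /translate_along opprD addrACA -scalerBr addrK.
apply: (le_trans (ler_euclidean_normD _ _ _)); rewrite lerD2l.
rewrite euclidean_normN euclidean_normZ -mulrA ler_wpM2l//.
rewrite /translate_along opprD addrACA -scalerBr addrK.
exact: v_lip.
Qed.

Lemma translate_along_inj : injective (translate_along v t).
Proof.
move=> p q pq; apply/subr0_eq/euclidean_norm_eq0/eqP.
have := translate_along_expanding p q; rewrite pq subrr.
rewrite eq_le euclidean_norm_ge0 andbT -(pmulr_rle0 _ (_ : 0 < 1 - `|t| * K)) ?subr_gt0//.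
move/le_trans; apply.
by rewrite /euclidean_norm expr0n addr0 sqrtr0.
Qed.

Lemma translate_along_surj p : exists q, translate_along v t q = p.
Proof.
have [||q qE] := @euclidean_contraction_fixpoint R (`|t| * K)
  (fun q => p - t *: v q) _ tK.
- by rewrite mulr_ge0.
- move=> q r.
  have -> : p - t *: v q - (p - t *: v r) = - (t *: (v q - v r)).
    by rewrite scalerBr opprD addrACA subrr add0r -opprD.
  by rewrite euclidean_normN euclidean_normZ -mulrA ler_wpM2l.
- by exists q; rewrite /translate_along /translate_along -[X in X + _]qE subrK.
Qed.

Lemma translate_along_bij : set_bij setT setT (translate_along v t).
Proof.
split=> [//|p q _ _|p _]; first exact: translate_along_inj.
by have [q qE] := translate_along_surj p; exists q.
Qed.

End translate_along_bijection.

(** * Measurable hulls and null sets for an outer measure *)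

Section caratheodory_hull.
Context {d : measure_display} {T : measurableType d} {R : realType}.
Variable mu : {measure set T -> \bar R}.

(** The hull is the intersection over [n] of unions of measurable covers that exceed the outer
    measure of [A] by at most [1 / (n + 1)]. *)
Lemma mu_ext_hull (A : set T) : (mu_ext mu A < +oo)%E ->
  exists B, [/\ measurable B, A `<=` B & mu_ext mu B = mu_ext mu A].
Proof.
move=> Aoo; have Afin : mu_ext mu A \is a fin_num.
  by rewrite ge0_fin_numE// outer_measure_ge0.
have ex_cover n : exists H, [/\ measurable H, A `<=` H &
    (mu_ext mu H <= mu_ext mu A + n.+1%:R^-1%:E)%E].
  have n0 : 0 < n.+1%:R^-1 :> R by [].
  have [_ [F [mF AF] <-] FA] := lb_ereal_inf_adherent n0 Afin.
  exists (\bigcup_k F k); split => //; first exact: bigcupT_measurable.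
  apply: le_trans (ltW FA).
  apply: (le_trans (outer_measure_sigma_subadditive (mu_ext mu) F)).
  apply: lee_nneseries => [i _ _|i _]; first exact: outer_measure_ge0.
  by rewrite -[leRHS](measurable_mu_extE mu (mF i)).
have [H HA] := choice ex_cover.
exists (\bigcap_n H n); split.
- by apply: bigcapT_measurable => n; have [] := HA n.
- by apply: sub_bigcap => n _; have [] := HA n.
apply/eqP; rewrite eq_le; apply/andP; split; last first.
  by apply: (le_outer_measure (mu_ext mu)); apply: sub_bigcap => n _; have [] := HA n.
apply/lee_addgt0Pr => e e0.
near \oo => n.
have [_ _ HAn] := HA n.
apply: (@le_trans _ _ (mu_ext mu (H n))).
  by apply: (le_outer_measure (mu_ext mu)); exact: bigcap_inf.
apply: (le_trans HAn); rewrite leeD2l// lee_fin ltW//.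
near: n; exact: (near_infty_natSinv_lt (PosNum e0)).
Unshelve. all: by end_near. Qed.

(** Caratheodory's condition, tested on the hull [B], splits its outer measure into those of [A] and
    [B \ A]; the finite value for [A] can be subtracted. *)
Lemma caratheodory_hull (A : set T) :
  (mu_ext mu).-caratheodory A -> (mu_ext mu A < +oo)%E ->
  exists B, [/\ measurable B, A `<=` B & mu_ext mu (B `\` A) = 0%E].
Proof.
move=> cA Aoo; have [B [mB AB BA]] := mu_ext_hull _ Aoo.
have Afin : mu_ext mu A \is a fin_num.
  by rewrite ge0_fin_numE// outer_measure_ge0.
exists B; split => //; have := cA B; rewrite (setIidr AB) BA -setDE addeC => AE.
by rewrite -(addeK (mu_ext mu (B `\` A)) Afin) -AE subee.
Qed.

Lemma caratheodory_null (N : set T) :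
  mu_ext mu N = 0%E -> (mu_ext mu).-caratheodory N.
Proof.
move=> N0; apply: le_caratheodory_measurable => X.
rewrite -[leRHS]add0e -[X in (_ <= X + _)%E]N0.
by apply: leeD; apply: (le_outer_measure (mu_ext mu));
  [exact: subIsetr|exact: subIsetl].
Qed.

End caratheodory_hull.

(** * Measurability of bi-Lipschitz images *)

Section plane_measurability.
Variable R : realType.
Local Notation plane := (measurableTypeR R * measurableTypeR R)%type.
Local Notation mu := (@lebesgue_measure R \x @lebesgue_measure R)%E.

Lemma open_measurable_plane (U : set (R * R)) :
  open U -> measurable (U : set plane).
Proof.
move=> oU.
(* Open rectangles with rational endpoints: a countable family of measurable sets, from which every
   open set is a union. *)
pose Q (c : rat * rat * rat * rat) : set plane :=
  `]ratr c.1.1.1, ratr c.1.1.2[%classic `*` `]ratr c.1.2, ratr c.2[%classic.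
have mQ c : measurable (Q c) by apply: measurableX; exact: measurable_itv.
have -> : U = \bigcup_(c in [set c | Q c `<=` U]) Q c.
  apply/seteqP; split => [[x y] Uxy|p [c /= + Qp]]; last exact.
  have /nbhs_ballP[e /= e0 eU] : nbhs (x, y) U by exact: open_nbhs_nbhs.
  have itv_near (z : R) : exists a b : rat,
      (z \in `]ratr a, ratr b[%R) /\ (`]ratr a, ratr b[%classic `<=` ball z e).
    have [a] : exists a : rat, ratr a \in `]z - e, z[%R.
      by apply: rat_in_itvoo; lra.
    have [b] : exists b : rat, ratr b \in `]z, z + e[%R.
      by apply: rat_in_itvoo; lra.
    rewrite !in_itv/= => /andP[zb be] /andP[ea az].
    exists a, b; split; first by rewrite in_itv/= az zb.
    move=> w; rewrite /= in_itv/= => /andP[aw wb].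
    by rewrite /ball/= ltr_distlC; apply/andP; split; lra.
  have [a [b [xab abe]]] := itv_near x.
  have [c [d [ycd cde]]] := itv_near y.
  exists (a, b, c, d) => [[x' y'] [/= x'ab y'cd]|].
    by apply: eU; split; [exact: abe|exact: cde].
  by split.
rewrite bigcup_mkcond; apply: countable_bigcupT_measurable => // c.
by case: ifPn.
Qed.

Lemma lipschitz_component_measurable (h : R * R -> R) (L : R) : 0 <= L ->
  (forall p q, `|h p - h q| <= L * euclidean_norm (p - q)) ->
  measurable_fun setT (h : plane -> measurableTypeR R).
Proof.
move=> L0 lipH.
have ray a : measurable ([set p | a < h p] : set plane).
  apply: open_measurable_plane; rewrite openE => p /= ap.
  (* A ball of [R * R] is a square, hence the factor [sqrt 2]. The summand [1] keeps the denominator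
     positive and leaves the margin [e] in [L * sqrt 2 * e = h p - a - e]. *)
  pose e := (h p - a) / (L * Num.sqrt 2 + 1).
  have D0 : 0 < L * Num.sqrt 2 + 1 by rewrite ltr_wpDl// mulr_ge0// sqrtr_ge0.
  have e0 : 0 < e by rewrite divr_gt0// subr_gt0.
  apply/nbhs_ballP; exists e => //= q [/= pq1 pq2].
  have : `|h p - h q| <= L * (Num.sqrt 2 * e).
    apply: (le_trans (lipH p q)); rewrite ler_wpM2l//.
    by apply: euclidean_norm_le; exact: ltW.
  have -> : L * (Num.sqrt 2 * e) = h p - a - e by rewrite /e; field; lra.
  by move=> /ler_normlP[_ +]; lra.
apply: (measurability (measurable : set (set (ocitv_type R)))) => //.
move=> _ [_ [[a b] _ <-] <-]; rewrite setTI.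
have -> : h @^-1` `]a, b] = [set p | a < h p] `\` [set p | b < h p].
  apply/seteqP; split => p /=; rewrite in_itv/=.
    by move=> /andP[-> pb]; split => //; apply/negP; rewrite -leNgt.
  by move=> [-> /negP]; rewrite -leNgt.
exact: measurableD.
Qed.

Lemma lipschitz_preimage_measurable (f : R * R -> R * R) (L : R)
  (B : set plane) : 0 <= L ->
  euclidean_lipschitz L f -> measurable B -> measurable (f @^-1` B : set plane).
Proof.
move=> L0 lipf mB.
have mf : measurable_fun setT (f : plane -> plane).
  apply/measurable_fun_pairP; split.
    apply: (@lipschitz_component_measurable (fst \o f) L) => // p q.
    exact: le_trans (euclidean_norm_ge_fst _ (f p - f q)) (lipf p q).
  apply: (@lipschitz_component_measurable (snd \o f) L) => // p q.
  exact: le_trans (euclidean_norm_ge_snd _ (f p - f q)) (lipf p q).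
by rewrite -[f @^-1` B]setTI; exact: mf.
Qed.

Lemma bilipschitz_image_measurable (f g : R * R -> R * R) (L M : R)
  (A : set (R * R)) : 0 < L -> 0 <= M -> cancel f g -> cancel g f ->
  euclidean_lipschitz L f -> euclidean_lipschitz M g ->
  lebesgue_measurable2 A -> lebesgue_measurable2 (f @` A).
Proof.
move=> L0 M0 fK gK lipf lipg.
(* Images commute with unions, so [A] may be cut along the squares that exhaust the plane. *)
wlog Aoo : A / (lebesgue_measure2 A < +oo)%E => [hwlog mA|mA].
  have [F FT mF] := @box_measure_sigma_finite R.
  have -> : A = \bigcup_n (A `&` F n) by rewrite -setI_bigcupr -FT setIT.
  rewrite image_bigcup.
  apply: (@bigcupT_measurable _ (caratheodory_type (mu_ext mu))) => n.
  have [mFn Fnoo] := mF n.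
  have mFn' : measurable (F n : set plane) by exact: box_measurable.
  apply: hwlog.
    apply: (@le_lt_trans _ _ (lebesgue_measure2 (F n))).
      by apply: le_lebesgue_measure2; exact: subIsetr.
    by rewrite /lebesgue_measure2 /completed_measure_extension measurable_mu_extE.
  apply: (@measurableI _ (caratheodory_type (mu_ext mu))) => //.
  exact: caratheodory_measurable_mu_ext.
have [B [mB AB BA0]] := caratheodory_hull _ _ mA Aoo.
(* As [g] inverts [f], the image of the Borel hull [B] is a preimage under the Lipschitz map [g],
   hence Borel, while the image of the null set [B \ A] is null. *)
have -> : f @` A = (g @^-1` B) `\` (f @` (B `\` A)).
  apply/seteqP; split => [_ [p Ap <-]|p [/= Bgp nfp]].
    split => /=; first by rewrite fK; exact: AB.
    by move=> [q [Bq nAq] /(can_inj fK) qp]; apply: nAq; rewrite qp.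
  exists (g p); last exact: gK.
  by apply: contrapT => nAgp; apply: nfp; exists (g p).
apply: (@measurableD _ (caratheodory_type (mu_ext mu))).
  apply: caratheodory_measurable_mu_ext.
  exact: lipschitz_preimage_measurable M0 lipg mB.
apply: caratheodory_null; apply/eqP.
rewrite eq_le outer_measure_ge0 andbT.
apply: (le_trans (lipschitz_image_le _ _ _ _ L0 lipf)).
by rewrite /lebesgue_measure2 /completed_measure_extension BA0 mule0.
Qed.

End plane_measurability.

(** * Bijectivity and the two-sided comparison of measures *)

Theorem lemma1 (R : realType) (v : R * R -> R * R) (K T : R)
    (v_unit : unit_vector_field v)
    (K_gt0 : 0 < K)
    (v_lip : euclidean_lipschitz K v)
    (T_gt0 : 0 < T)
    (T_lt : T < 1 / K) :
  (forall t : R, `|t| <= T -> set_bij setT setT (translate_along v t)) /\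
  (forall (A : set (R * R)) (s : R),
    lebesgue_measurable2 A -> `|s| <= T ->
    lebesgue_measurable2 (translate_along v s @` A) /\
    ((1 / (2 * pi * (1 + `|s| * K) ^+ 2))%:E
         * lebesgue_measure2 (translate_along v s @` A)
       <= lebesgue_measure2 A)%E /\
    (lebesgue_measure2 A
       <= (2 * pi * (1 / (1 - `|s| * K)) ^+ 2)%:E
         * lebesgue_measure2 (translate_along v s @` A))%E).
Proof.
have tK (t : R) : `|t| <= T -> `|t| * K < 1.
  by move=> /le_lt_trans/(_ T_lt); rewrite ltr_pdivlMr.
have K0 := ltW K_gt0.
split=> [t /tK t1|A s mA /tK s1]; first exact: translate_along_bij v_lip t1 K0.
pose S := translate_along v s.
have S_inj : injective S := translate_along_inj _ _ _ _ v_lip s1.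
(* Surjectivity gives a right inverse by choice; injectivity makes it two-sided. *)
have [g gK] := choice (translate_along_surj _ _ _ _ v_lip s1 K0).
have Kg : cancel S g by move=> p; apply: S_inj; exact: gK.
have L0 : 0 < 1 + `|s| * K by rewrite ltr_wpDr// mulr_ge0.
have M0 : 0 < 1 / (1 - `|s| * K) by rewrite divr_gt0// subr_gt0.
have lipS : euclidean_lipschitz (1 + `|s| * K) S.
  exact: translate_along_lipschitz.
have lipg : euclidean_lipschitz (1 / (1 - `|s| * K)) g.
  move=> p q; rewrite mul1r mulrC ler_pdivlMr ?subr_gt0// mulrC.
  by have := translate_along_expanding R v K s v_lip (g p) (g q); rewrite !gK.
have image_le (f : R * R -> R * R) (L : R) (B : set (R * R)) : 0 < L ->
    euclidean_lipschitz L f ->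
    (lebesgue_measure2 (f @` B)
       <= (2 * pi * L ^+ 2)%:E * lebesgue_measure2 B)%E.
  move=> L1 lipf; apply: (le_trans (lipschitz_image_le _ _ _ _ L1 lipf)).
  rewrite lee_wpmul2r ?lebesgue_measure2_ge0// lee_fin ler_wpM2r ?sqr_ge0//.
  (* The factor [4] from covering is at most [2 * pi] because [pi >= 2]. *)
  by have := pi_ge2 R; lra.
split; first exact: bilipschitz_image_measurable L0 (ltW M0) Kg gK lipS lipg mA.
split.
  rewrite div1r lee_pdivrMl; first exact: image_le.
  by rewrite !mulr_gt0// ?pi_gt0// exprn_gt0.
have AE : A = g @` (S @` A) by rewrite image_comp eq_image_id// => p _; exact: Kg.
by rewrite {1}AE; exact: image_le.
Qed.
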